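(* Let $K$ be a convex body in $\mathbb{R}^2$ and let $C\subset\mathbb{R}^2$ be a Minkowski-centered convex body with $0$ in its interior. Then for every $\mathrm{M}\in\{\mathrm{MIN},\mathrm{HM},\mathrm{AM},\mathrm{MAX}\}$, $$D_{\mathrm{M}}(K,C)\ge R(K,C).$$
   Context: A convex body is a nonempty compact convex set. $h_C(a)=\max_{x\in C}a^Tx$ is the support function and $\|x\|_C=\min\{\lambda\ge0:x\in\lambda C\}$ the gauge function. The circumradius is $R(K,C)=\inf\{\rho\ge0:\exists t,\ K\subset t+\rho C\}$. The Minkowski asymmetry is $s(C)=R(C,-C)$, and $C$ is Minkowski-centered if $C\subset -s(C)C$. The four diameters are $$D_{\mathrm{MIN}}(K,C)=\max_{x,y\in K}\|x-y\|_C,\qquad D_{\mathrm{HM}}(K,C)=\max_{x,y\in K}\tfrac12(\|x-y\|_C+\|x-y\|_{-C}),$$ $$D_{\mathrm{AM}}(K,C)=\max_{x,y\in K}2R([x,y],C),\qquad D_{\mathrm{MAX}}(K,C)=\max_{u\ne0}\frac{h_K(u)+h_K(-u)}{\max(h_C(u),h_C(-u))},$$ where $[x,y]$ is the segment with endpoints $x,y$. *)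

(* Defs.v *)
From HB Require Import structures.
From mathcomp Require Import all_boot all_order all_algebra.
From mathcomp Require Import all_classical all_reals all_analysis.

Set Implicit Arguments.
Unset Strict Implicit.
Unset Printing Implicit Defensive.

Import Order.TTheory GRing.Theory Num.Theory.
Import numFieldNormedType.Exports.

Local Open Scope classical_set_scope.
Local Open Scope ring_scope.

(* Points of R^n are row vectors. Every "max" below is rendered by [sup] and
   every "min" by [inf], over sets of reals. The library's [sup] (resp. [inf])
   is 0 on sets that are empty or unbounded above (resp. below); for n > 0,
   nonempty compact K and compact convex C with 0 in the interior (the setting in which
   these notions are used) all the sets involved are nonempty and bounded on
   the relevant side, and the maxima and minima are attained. *)

Definition convex_body (R : realType) (n : nat) (C : set 'rV[R]_n) : Prop :=
  [/\ C !=set0, compact C & convex_set C].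

Definition dilate (R : realType) (n : nat) (l : R) (C : set 'rV[R]_n) :
  set 'rV[R]_n := [set l *: c | c in C].

Definition reflect_set (R : realType) (n : nat) (C : set 'rV[R]_n) :
  set 'rV[R]_n := [set - c | c in C].

Definition translate (R : realType) (n : nat) (t : 'rV[R]_n)
  (C : set 'rV[R]_n) : set 'rV[R]_n := [set t + c | c in C].

Definition segment_set (R : realType) (n : nat) (x y : 'rV[R]_n) :
  set 'rV[R]_n := [set (1 - t) *: x + t *: y | t in `[0, 1]%classic].

Definition support_fun (R : realType) (n : nat) (C : set 'rV[R]_n)
  (a : 'rV[R]_n) : R := sup [set (a *m x^T) 0 0 | x in C].

Definition gauge_fun (R : realType) (n : nat) (C : set 'rV[R]_n)
  (x : 'rV[R]_n) : R := inf [set l : R | 0 <= l /\ dilate l C x].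

Definition circumradius (R : realType) (n : nat) (K C : set 'rV[R]_n) : R :=
  inf [set rho : R |
    0 <= rho /\ exists t : 'rV[R]_n, K `<=` translate t (dilate rho C)].

Definition minkowski_asymmetry (R : realType) (n : nat) (C : set 'rV[R]_n) :
  R := circumradius C (reflect_set C).

Definition minkowski_centered (R : realType) (n : nat) (C : set 'rV[R]_n) :
  Prop := C `<=` dilate (- minkowski_asymmetry C) C.

Definition diam_MIN (R : realType) (n : nat) (K C : set 'rV[R]_n) : R :=
  sup [set gauge_fun C (x - y) | x in K & y in K].

Definition diam_HM (R : realType) (n : nat) (K C : set 'rV[R]_n) : R :=
  sup [set 2^-1 * (gauge_fun C (x - y) + gauge_fun (reflect_set C) (x - y))
      | x in K & y in K].

Definition diam_AM (R : realType) (n : nat) (K C : set 'rV[R]_n) : R :=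
  sup [set 2 * circumradius (segment_set x y) C | x in K & y in K].

Definition diam_MAX (R : realType) (n : nat) (K C : set 'rV[R]_n) : R :=
  sup [set (support_fun K u + support_fun K (- u)) /
           Num.max (support_fun C u) (support_fun C (- u))
      | u in [set u : 'rV[R]_n | u != 0]].

Inductive mean_kind : Set := MIN | HM | AM | MAX.

Definition diam (R : realType) (n : nat) (M : mean_kind)
  (K C : set 'rV[R]_n) : R :=
  match M with
  | MIN => diam_MIN K C
  | HM => diam_HM K C
  | AM => diam_AM K C
  | MAX => diam_MAX K C
  end.

(* Main.v *)
Require Import Defs.
From HB Require Import structures.
From mathcomp Require Import all_boot all_order all_algebra.
From mathcomp Require Import all_classical all_reals all_analysis.
From mathcomp Require Import ring lra.

Import Order.TTheory GRing.Theory Num.Theory.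
Import numFieldNormedType.Exports.

Local Open Scope classical_set_scope.
Local Open Scope ring_scope.

(** Write [h] for the support function of [C] and
    [g u = max (h u) (h (- u))].  Each of the four diameters, in its own way,
    bounds the widths of [K]: if [rho] exceeds the diameter, then
    [u . (x - y) <= rho * g u] for all [x], [y] in [K] and all [u]
    (lemmas [width_le_diam_*]).  It remains to turn these bounds into a
    translate of [rho C] that covers [K].

    In the plane, [K] has a translate inside [C] as soon as no triangle
    circumscribed to [C] prevents it, that is, as soon as
    [h_K u + h_K v + h_K w <= h_C u + h_C v + h_C w] whenever
    [u + v + w = 0] ([containment_triples]).  This is a Helly-type statement,
    obtained here as a Hahn-Banach theorem for [f = h_K - h_C]: a linear form
    above [f] is a translation vector.  The extension is made one coordinate
    at a time and needs [f] to have nonpositive sum on four vectors of sum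
    zero; by Caratheodory's argument three vectors are enough.

    Two applications of the criterion finish the proof.
    - Subadditivity of [h] gives the criterion for [C] and [- 2 C], so the
      Minkowski asymmetry of a planar body is at most [2].  Centeredness then
      gives [h (- u) <= 2 * h u] ([support_opp_le]).
    - For [K] and [rho C], let [u + v + w = 0] and let [p], [q], [r] in [K]
      realize [h_K] at [u], [v], [w].  Put [e a = max 0 (h (- a) - h a)], so
      that [0 <= e a <= h a] by the previous point.  With
      [E = e u + e v + e w], the number [E * (u . p + v . q + w . r)] is a sum
      of three terms such as [(e v *: w - e w *: v) . (r - q)].  The
      coefficients are chosen so that [e v *: w - e w *: v] and its opposite
      receive the same upper bound [e v * h w + e w * h v + e v * e w] from
      the subadditivity of [h].  The three width bounds add up to at most
      [rho * E * (h u + h v + h w)], because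
      [sum of products e_i e_j <= sum e_i ^ 2 <= sum e_i h_i]
      ([triple_from_widths]). *)

(** * The scalar product *)

Definition dot {R : realType} {n : nat} (u x : 'rV[R]_n) : R :=
  (u *m x^T) 0 0.

Lemma dotE {R : realType} {n : nat} (u x : 'rV[R]_n) :
  dot u x = \sum_i u 0 i * x 0 i.
Proof. by rewrite /dot mxE; apply: eq_bigr => i _; rewrite mxE. Qed.

Lemma dotC {R : realType} {n : nat} (u x : 'rV[R]_n) : dot u x = dot x u.
Proof. by rewrite !dotE; apply: eq_bigr => i _; rewrite mulrC. Qed.

Lemma dotDl {R : realType} {n : nat} (u v x : 'rV[R]_n) :
  dot (u + v) x = dot u x + dot v x.
Proof. by rewrite /dot mulmxDl mxE. Qed.

Lemma dotZl {R : realType} {n : nat} (a : R) (u x : 'rV[R]_n) :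
  dot (a *: u) x = a * dot u x.
Proof. by rewrite /dot -scalemxAl mxE. Qed.

Lemma dotNl {R : realType} {n : nat} (u x : 'rV[R]_n) :
  dot (- u) x = - dot u x.
Proof. by rewrite -scaleN1r dotZl mulN1r. Qed.

Lemma dotDr {R : realType} {n : nat} (u x y : 'rV[R]_n) :
  dot u (x + y) = dot u x + dot u y.
Proof. by rewrite dotC dotDl !(dotC u). Qed.

Lemma dotZr {R : realType} {n : nat} (a : R) (u x : 'rV[R]_n) :
  dot u (a *: x) = a * dot u x.
Proof. by rewrite dotC dotZl dotC. Qed.

Lemma dotNr {R : realType} {n : nat} (u x : 'rV[R]_n) :
  dot u (- x) = - dot u x.
Proof. by rewrite dotC dotNl dotC. Qed.

Lemma dot0l {R : realType} {n : nat} (x : 'rV[R]_n) : dot 0 x = 0.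
Proof. by rewrite -(scale0r 0) dotZl mul0r. Qed.

Lemma dot0r {R : realType} {n : nat} (u : 'rV[R]_n) : dot u 0 = 0.
Proof. by rewrite dotC dot0l. Qed.

Definition dot_lin := (@dotDl, @dotDr, @dotNl, @dotNr, @dotZl, @dotZr).

Lemma dot_sqrBZ {R : realType} {n : nat} (l : R) (u w : 'rV[R]_n) :
  dot (u - l *: w) (u - l *: w) =
  dot u u - 2 * l * dot u w + l ^+ 2 * dot w w.
Proof. by rewrite !dot_lin (dotC w u); ring. Qed.

Lemma dot_ge0 {R : realType} {n : nat} (u : 'rV[R]_n) : 0 <= dot u u.
Proof. by rewrite dotE; apply: sumr_ge0 => i _; rewrite -expr2 sqr_ge0. Qed.

Lemma dot_gt0 {R : realType} {n : nat} (u : 'rV[R]_n) : u != 0 -> 0 < dot u u.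
Proof.
move=> u0; rewrite lt_neqAle dot_ge0 andbT eq_sym; apply: contra u0.
rewrite dotE psumr_eq0; last by move=> i _; rewrite -expr2 sqr_ge0.
move=> /allP u0; apply/eqP/rowP => i; rewrite mxE.
by have := u0 i; rewrite mem_index_enum -expr2 sqrf_eq0 => /(_ isT)/eqP.
Qed.

Lemma continuous_dot {R : realType} {n : nat} (f g : 'rV[R]_n -> 'rV[R]_n) :
  continuous f -> continuous g -> continuous (fun x => dot (f x) (g x)).
Proof.
move=> cf cg.
have -> : (fun x => dot (f x) (g x)) =
    (fun x => \sum_(i <- index_enum 'I_n) (f x 0 i * g x 0 i)).
  by apply/funext => x; rewrite dotE.
apply: continuous_big => [|i _ x]; first exact: add_continuous.
have coord (h : 'rV[R]_n -> 'rV[R]_n) : continuous h ->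
    continuous (fun y => h y 0 i).
  move=> ch y.
  have cc : {for h y, continuous (fun z : 'rV[R]_n => z 0 i)}.
    exact: coord_continuous.
  exact: (continuous_comp (ch y) cc).
apply: (cvgM (coord f cf x) (coord g cg x)).
Qed.

(** * Support functions of convex bodies *)

Lemma support_spec {R : realType} {n : nat} {C : set 'rV[R]_n}
    (u : 'rV[R]_n) : convex_body C ->
  exists2 c, C c /\ support_fun C u = dot u c &
    forall x, C x -> dot u x <= support_fun C u.
Proof.
move=> [C0 cC _].
have cf : continuous (dot u).
  by apply: (@continuous_dot _ _ (fun=> u) id) => x;
    [exact: cst_continuous | exact: cvg_id].
have [c] := EVT_max_rV C0 cC (continuous_subspaceT cf).
rewrite inE => Cc cmax.
have cub : ubound [set dot u x | x in C] (dot u c).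
  by move=> _ [x Cx <-]; apply: cmax; rewrite inE.
have -> : support_fun C u = dot u c.
  apply/eqP; rewrite eq_le; apply/andP.
  split; first by apply: ge_sup => //; exists (dot u c), c.
  by apply: ub_le_sup; [exists (dot u c) | exists c].
by exists c => // x Cx; apply: cub; exists x.
Qed.

Lemma support_attained {R : realType} {n : nat} {C : set 'rV[R]_n}
    (u : 'rV[R]_n) : convex_body C ->
  exists2 c, C c & support_fun C u = dot u c.
Proof. by move=> /(support_spec u) [c [Cc cE] _]; exists c. Qed.

Lemma dot_le_support {R : realType} {n : nat} {C : set 'rV[R]_n}
    (u c : 'rV[R]_n) : convex_body C -> C c -> dot u c <= support_fun C u.
Proof. by move=> /(support_spec u) [_ _]; exact. Qed.

Lemma support_le {R : realType} {n : nat} {C : set 'rV[R]_n}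
    (u : 'rV[R]_n) (b : R) : convex_body C ->
  (forall c, C c -> dot u c <= b) -> support_fun C u <= b.
Proof. by move=> hC Cb; have [c Cc ->] := support_attained u hC; exact: Cb. Qed.

Lemma supportZ {R : realType} {n : nat} {C : set 'rV[R]_n} (a : R)
    (u : 'rV[R]_n) : convex_body C -> 0 <= a ->
  support_fun C (a *: u) = a * support_fun C u.
Proof.
move=> hC a0; apply/eqP; rewrite eq_le; apply/andP; split.
  apply: support_le => // c Cc; rewrite dotZl ler_wpM2l //.
  exact: dot_le_support.
have [c Cc ->] := support_attained u hC.
by rewrite -dotZl; exact: dot_le_support.
Qed.

Lemma support0 {R : realType} {n : nat} {C : set 'rV[R]_n} :
  convex_body C -> support_fun C 0 = 0.
Proof. by move=> hC; rewrite -(scale0r 0) supportZ // mul0r. Qed.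

Lemma support_ge0 {R : realType} {n : nat} {C : set 'rV[R]_n} (u : 'rV[R]_n) :
  convex_body C -> C 0 -> 0 <= support_fun C u.
Proof. by move=> hC C0; rewrite -(dot0r u); exact: dot_le_support. Qed.

Lemma supportD {R : realType} {n : nat} {C : set 'rV[R]_n}
    (u v : 'rV[R]_n) : convex_body C ->
  support_fun C (u + v) <= support_fun C u + support_fun C v.
Proof.
move=> hC; apply: support_le => // c Cc.
by rewrite dotDl lerD // dot_le_support.
Qed.

(** Membership in terms of an explicit real parameter, instead of the packaged
    interval element of the abstract convexity structure. *)
Lemma convex_setP {R : realType} {n : nat} (C : set 'rV[R]_n) :
  convex_set C <->
  forall (x y : 'rV[R]_n) (l : R), C x -> C y -> 0 <= l -> l <= 1 ->
    C (l *: x + (1 - l) *: y).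
Proof.
split=> [cC x y l Cx Cy l0 l1|cC x y l].
  have hl : Itv.spec (@Itv.num_sem R) (Itv.Real `[0%Z, 1%Z]%O) l.
    by apply/and3P; split; rewrite ?num_real // bnd_simp.
  have := cC x y (Itv.mk hl); rewrite !inE => /(_ Cx Cy).
  by [].
rewrite !inE => Cx Cy.
by apply: (cC x y l%:num) => //.
Qed.

Lemma convex_body_dilate {R : realType} {n : nat} (a : R) (C : set 'rV[R]_n) :
  convex_body C -> convex_body (dilate a C).
Proof.
move=> [[c Cc] cC /convex_setP xC]; split.
- by exists (a *: c), c.
- apply: (@continuous_compact _ _ (fun x : 'rV[R]_n => a *: x)) => //.
  by apply: continuous_subspaceT => x; exact: scaler_continuous.
- apply/convex_setP => _ _ l [x Cx <-] [y Cy <-] l0 l1.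
  exists (l *: x + (1 - l) *: y); first exact: xC.
  by rewrite scalerDr !scalerA mulrC (mulrC a).
Qed.

Lemma reflect_dilate {R : realType} {n : nat} (C : set 'rV[R]_n) :
  reflect_set C = dilate (-1) C.
Proof.
by rewrite /reflect_set /dilate; apply: eq_imagel => x _; rewrite scaleN1r.
Qed.

Lemma support_dilate {R : realType} {n : nat} (a : R) (C : set 'rV[R]_n)
    (u : 'rV[R]_n) :
  support_fun (dilate a C) u = support_fun C (a *: u).
Proof.
rewrite /support_fun /dilate image_comp; congr (sup _).
by apply: eq_imagel => x _ /=; rewrite -!/(dot _ _) dotZl dotZr.
Qed.

(** A compact convex set is cut out by its supporting half-spaces.  If [c] is
    the point of [C] nearest to [x] and [u = x - c], the hypothesis provides a
    point [d] of [C] at least as far as [x] in the direction [u], and moving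
    from [c] towards [d] would bring us closer to [x] unless [u = 0]. *)
Lemma separation {R : realType} {n : nat} {C : set 'rV[R]_n} {x : 'rV[R]_n} :
  convex_body C -> (forall u, dot u x <= support_fun C u) -> C x.
Proof.
move=> hC xC; have [C0 cC /convex_setP vC] := hC.
have cf : continuous (fun c : 'rV[R]_n => dot (x - c) (x - c)).
  have cx : continuous (fun c : 'rV[R]_n => x - c).
    move=> c; have h : (fun=> x) @ nbhs c --> nbhs x.
      by apply: cvg_cst; exact: nbhs_filter.
    have h2 : id @ nbhs c --> nbhs c by exact: cvg_id.
    exact: (@cvgB _ _ _ (nbhs c) (nbhs_filter c) (fun=> x) id x c h h2).
  exact: continuous_dot.
have [c] := EVT_min_rV C0 cC (continuous_subspaceT cf).
rewrite inE => Cc cmin.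
have [/eqP|nz] := eqVneq (x - c) 0; first by rewrite subr_eq0 => /eqP ->.
have [d Cd dmax] := support_attained (x - c) hC.
have := xC (x - c); rewrite dmax => {}dmax.
set u := x - c in nz dmax *.
have u0 := dot_gt0 _ nz.
have ud : dot u u <= dot u (d - c).
  by move: dmax; rewrite {2 4}/u !dot_lin; lra.
have step l : 0 <= l -> l <= 1 ->
    2 * l * dot u u <= l ^+ 2 * dot (d - c) (d - c).
  move=> l0 l1; have := cmin (l *: d + (1 - l) *: c).
  rewrite inE => /(_ (vC _ _ _ Cd Cc l0 l1)).
  have -> : x - (l *: d + (1 - l) *: c) = u - l *: (d - c).
    by rewrite /u; apply/rowP => i; rewrite !mxE; ring.
  rewrite -/u dot_sqrBZ => h.
  by have := ler_wpM2l l0 ud; lra.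
(* For this step length the quadratic term is dominated by the linear one. *)
set q := dot (d - c) (d - c) in step.
have q0 : 0 <= q by exact: dot_ge0.
have t0 : 0 < dot u u + q by lra.
have := step (dot u u / (dot u u + q)); set l := _ / (_ + _).
have l0 : 0 < l by exact: divr_gt0.
have l1 : l <= 1 by rewrite /l ler_pdivrMr //; lra.
have lE : l * (dot u u + q) = dot u u by rewrite /l mulfVK ?gt_eqF.
move=> /(_ (ltW l0) l1).
have lu0 : 0 < l * dot u u by exact: mulr_gt0.
have : l * (l * q) <= l * dot u u by rewrite ler_pM2l //; lra.
by lra.
Qed.

(** * Translative containment in the plane *)

(** Four vectors of the plane satisfy a linear relation that is not
    proportional to the one with all coefficients equal: the space of
    relations has dimension at least two. *)
Lemma zero_sum_relation {R : realType} (u : 'I_4 -> 'rV[R]_2) :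
  exists2 mu : 'I_4 -> R, \sum_i mu i *: u i = 0 & exists i j, mu i < mu j.
Proof.
pose A := \matrix_(i < 4) u i.
have : ~~ (kermx A <= (const_mx 1 : 'rV[R]_4))%MS.
  apply/negP => /mxrankS; rewrite mxrank_ker.
  have rA := rank_leq_col A; have r1 := rank_leq_row (const_mx 1 : 'rV[R]_4).
  by move=> h; have := leq_trans (leq_trans (leq_sub2l 4 rA) h) r1.
move=> /row_subPn [k kP]; exists (fun i => kermx A k i).
  have : row k (kermx A) *m A = 0 by rewrite -row_mul mulmx_ker row0.
  rewrite mulmx_sum_row => kA; rewrite -[RHS]kA; apply: eq_bigr => i _.
  by rewrite rowK !mxE.
have [j jP] : exists j, kermx A k j != kermx A k 0.
  apply/existsP; apply: contraNT kP => /existsPn kP.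
  have -> : row k (kermx A) = kermx A k 0 *: const_mx 1.
    apply/rowP => j; rewrite mxE [RHS]mxE [X in _ * X]mxE mulr1.
    by have /negPn/eqP := kP j.
  exact: scalemx_sub.
move: jP; rewrite neq_lt => /orP [] h; first by exists j, 0.
by exists 0, j.
Qed.

(** In this section [f] stands for a difference of support functions; it is
    positively homogeneous, but neither convex nor concave. *)
Section Majorant.
Context {R : realType} (f : 'rV[R]_2 -> R).
Hypothesis fZ : forall (a : R) u, 0 <= a -> f (a *: u) = a * f u.
Hypothesis f3 : forall u v w, u + v + w = 0 -> f u + f v + f w <= 0.

Let f0 : f 0 = 0.
Proof. by rewrite -(scale0r 0) fZ // mul0r. Qed.

Let sum_le0_of_zero (u : 'I_4 -> 'rV[R]_2) (i : 'I_4) :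
  u i = 0 -> \sum_j u j = 0 -> \sum_j f (u j) <= 0.
Proof.
move=> ui; rewrite !(bigD1_ord i) //= ui f0 !add0r !big_ord_recl !big_ord0.
by rewrite !addr0 !addrA => /f3.
Qed.

(** Caratheodory's argument: the relation with all coefficients equal to one is
    the sum of the relations with coefficients [w] and [1 - w], both
    nonnegative and each missing one of the four vectors. *)
Lemma sum_four_le0 (u : 'I_4 -> 'rV[R]_2) :
  \sum_i u i = 0 -> \sum_i f (u i) <= 0.
Proof.
move=> u0; have [mu mu0 [i [j ij]]] := zero_sum_relation u.
pose p := [arg min_(k < i) mu k]%O; pose q := [arg max_(k > i) mu k]%O.
have pP k : mu p <= mu k by rewrite /p; case: arg_minP => // l _; exact.
have qP k : mu k <= mu q by rewrite /q; case: arg_maxP => // l _; exact.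
have d0 : 0 < mu q - mu p.
  by rewrite subr_gt0 (le_lt_trans (pP i)) // (lt_le_trans ij).
pose w k := (mu k - mu p) / (mu q - mu p).
have w0 k : 0 <= w k by rewrite divr_ge0 ?(ltW d0) // subr_ge0.
have w1 k : 0 <= 1 - w k by rewrite subr_ge0 ler_pdivrMr // mul1r lerB.
have wu0 : \sum_k w k *: u k = 0.
  transitivity ((mu q - mu p)^-1 *: (\sum_k mu k *: u k - mu p *: \sum_k u k)).
    rewrite scaler_sumr -sumrB scaler_sumr; apply: eq_bigr => k _.
    by rewrite -scalerBl scalerA mulrC.
  by rewrite mu0 u0 scaler0 subr0 scaler0.
have lo : \sum_k f (w k *: u k) <= 0.
  by apply: (@sum_le0_of_zero _ p) => //; rewrite /w subrr mul0r scale0r.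
have hi : \sum_k f ((1 - w k) *: u k) <= 0.
  apply: (@sum_le0_of_zero _ q).
    by rewrite /w divff ?gt_eqF // subrr scale0r.
  by under eq_bigr do rewrite scalerBl scale1r; rewrite sumrB u0 wu0 subrr.
have := lerD lo hi; rewrite -big_split /= addr0; congr (_ <= _).
by apply: eq_bigr => k _; rewrite !fZ //; ring.
Qed.

Let f4 (a b c d : 'rV[R]_2) : a + b + (c + d) = 0 ->
  f a + f b + (f c + f d) <= 0.
Proof.
move=> s0; have := @sum_four_le0 (fun i => nth 0 [:: a; b; c; d] i).
by rewrite !big_ord_recl !big_ord0 /= !addr0 !addrA in s0 * => /(_ s0).
Qed.

Let sup_between (L U : set R) : L !=set0 -> U !=set0 ->
  (forall l h, L l -> U h -> l <= h) ->
  exists2 t, forall l, L l -> l <= t & forall h, U h -> t <= h.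
Proof.
move=> L0 [h0 Uh0] LU; exists (sup L) => [l Ll|h Uh].
  by apply: ub_le_sup => //; exists h0 => x Lx; exact: LU.
by apply: ge_sup => // x Lx; exact: LU.
Qed.

(** A Hahn-Banach extension: [t1] is a slope on the first axis that is
    compatible with all pairs of vectors whose sum lies on this axis; this is
    exactly what allows the slope [t2] on the second axis to exist. *)
Lemma linear_majorant : exists t, forall u, f u <= dot u t.
Proof.
pose e1 : 'rV[R]_2 := delta_mx 0 0.
have [t1 lb1 ub1] : exists2 t1,
    forall a b, a + b = e1 -> f a + f b <= t1 &
    forall a b, a + b = - e1 -> f a + f b <= - t1.
  have [|||t tL tU] := @sup_between
    [set x | exists a b, a + b = e1 /\ x = f a + f b]
    [set x | exists a b, a + b = - e1 /\ x = - (f a + f b)].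
  - by exists (f e1 + f 0), e1, 0; rewrite addr0.
  - by exists (- (f (- e1) + f 0)), (- e1), 0; rewrite addr0.
  - move=> _ _ [a [b [ab ->]]] [c [d [cd ->]]].
    by rewrite -subr_le0 opprK; apply: f4; rewrite ab cd subrr.
  exists t => a b ab; first by apply: tL; exists a, b.
  by rewrite lerNr; apply: tU; exists a, b.
have H1 x a b : a + b = x *: e1 -> f a + f b <= t1 * x.
  move=> ab; have [x0|x0|x0] := ltgtP x 0.
  - have nx : 0 <= - x by lra.
    have := lb1. have := ub1 ((- x)^-1 *: a) ((- x)^-1 *: b).
    rewrite -scalerDr ab scalerA invrN mulNr mulVf ?lt_eqF // scaleN1r.
    move=> /(_ erefl); rewrite -invrN !fZ ?invr_ge0 // -mulrDr.
    by rewrite mulrC ler_pdivrMr ?oppr_gt0 // mulrNN.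
  - have := lb1 (x^-1 *: a) (x^-1 *: b).
    rewrite -scalerDr ab scalerA mulVf ?gt_eqF // scale1r => /(_ erefl).
    rewrite !fZ ?invr_ge0 ?(ltW x0) // -mulrDr.
    by rewrite mulrC ler_pdivrMr.
  - rewrite x0 mulr0; have := @f3 a b 0; rewrite addr0 ab x0 scale0r f0 addr0.
    exact.
pose X (u : 'rV[R]_2) := u 0 0; pose Y (u : 'rV[R]_2) := u 0 1.
have XY u v : Y u + Y v = 0 -> u + v = (X u + X v) *: e1.
  move=> Y0; apply/rowP => j; rewrite !mxE /=.
  have [->|jn0] := eqVneq j 0; first by rewrite mulr1.
  have -> : j = 1 by apply/val_inj; case: j jn0 => [[|[|]]].
  by rewrite mulr0.
have [t2 lb2 ub2] : exists2 t2,
    forall u, Y u = 1 -> f u - t1 * X u <= t2 &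
    forall u, Y u = -1 -> f u - t1 * X u <= - t2.
  pose e2 : 'rV[R]_2 := delta_mx 0 1.
  have [|||t tL tU] := @sup_between
    [set x | exists2 u, Y u = 1 & x = f u - t1 * X u]
    [set x | exists2 u, Y u = -1 & x = - (f u - t1 * X u)].
  - by exists (f e2 - t1 * X e2), e2; rewrite // /Y !mxE.
  - by exists (- (f (- e2) - t1 * X (- e2))), (- e2); rewrite // /Y !mxE.
  - move=> _ _ [u uY ->] [v vY ->].
    have := H1 (X u + X v) u v; rewrite XY ?uY ?vY ?subrr // => /(_ erefl).
    lra.
  exists t => u uY; first by apply: tL; exists u.
  by rewrite lerNr; apply: tU; exists u.
exists (t1 *: e1 + t2 *: delta_mx 0 1) => u.
have -> : dot u (t1 *: e1 + t2 *: delta_mx 0 1) = t1 * X u + t2 * Y u.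
  rewrite dotE !big_ord_recl big_ord0 !mxE /=.
  have -> : lift ord0 ord0 = 1 :> 'I_2 by apply/val_inj.
  by rewrite /X /Y; ring.
have XZ a : X (a *: u) = a * X u by rewrite /X mxE.
have YZ a : Y (a *: u) = a * Y u by rewrite /Y mxE.
have [y0|y0|y0] := ltgtP (Y u) 0.
- have ny : 0 < - Y u by lra.
  have := ub2 ((- Y u)^-1 *: u); rewrite XZ YZ invrN mulNr mulVf ?lt_eqF //.
  move=> /(_ erefl); rewrite -invrN fZ ?invr_ge0 ?(ltW ny) // mulrCA -mulrBr.
  by rewrite mulrC ler_pdivrMr //; lra.
- have := lb2 ((Y u)^-1 *: u); rewrite XZ YZ mulVf ?gt_eqF //.
  move=> /(_ erefl); rewrite fZ ?invr_ge0 ?(ltW y0) // mulrCA -mulrBr.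
  by rewrite mulrC ler_pdivrMr //; lra.
- have := H1 (X u) u 0; rewrite f0 addr0 y0 => h.
  have : u = X u *: e1.
    have := XY u 0; rewrite addr0 {1}y0 /Y mxE addr0 /X mxE addr0; exact.
  by rewrite addr0 in h * => /h; lra.
Qed.

End Majorant.

(** Only triples are tested, because the translation vector of a planar body
    has two coordinates. *)
Lemma containment_triples {R : realType} (K C : set 'rV[R]_2) :
  convex_body K -> convex_body C ->
  (forall u v w, u + v + w = 0 ->
    support_fun K u + support_fun K v + support_fun K w <=
    support_fun C u + support_fun C v + support_fun C w) ->
  exists t, K `<=` translate t C.
Proof.
move=> hK hC KC.
have [|u v w /KC|t tP] := @linear_majorant R
  (fun u => support_fun K u - support_fun C u).
- by move=> a u a0; rewrite !supportZ // mulrBr.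
- lra.
exists t => x Kx; exists (x - t); last by rewrite addrC subrK.
apply: separation => // u; rewrite dotDr dotNr.
by have := tP u; have := dot_le_support u x hK Kx; lra.
Qed.

Lemma circumradius_le {R : realType} {n : nat} {K C : set 'rV[R]_n} {rho : R}
    {t : 'rV[R]_n} :
  0 <= rho -> K `<=` translate t (dilate rho C) -> circumradius K C <= rho.
Proof.
move=> r0 Kt; apply: ge_inf; first by exists 0 => x [].
by split => //; exists t.
Qed.

Lemma support_reflect {R : realType} {n : nat} (C : set 'rV[R]_n)
    (u : 'rV[R]_n) :
  support_fun (reflect_set C) u = support_fun C (- u).
Proof. by rewrite reflect_dilate support_dilate scaleN1r. Qed.

Lemma convex_body_reflect {R : realType} {n : nat} (C : set 'rV[R]_n) :
  convex_body C -> convex_body (reflect_set C).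
Proof. by rewrite reflect_dilate; exact: convex_body_dilate. Qed.

(** * The Minkowski asymmetry of a planar body *)

(** Minkowski's bound, in dimension two: the containment criterion for [C] and
    [- 2 C] is the sum of three instances of [h u <= h (- v) + h (- w)]. *)
Lemma asymmetry_le2 {R : realType} (C : set 'rV[R]_2) :
  convex_body C -> 0 <= minkowski_asymmetry C <= 2.
Proof.
move=> hC.
have hC' := convex_body_reflect C hC.
have [|u v w uvw|t tP] :=
    @containment_triples R C (dilate 2 (reflect_set C)) hC.
- exact: convex_body_dilate.
- have tri a b c : a + b + c = 0 ->
      support_fun C a <= support_fun C (- b) + support_fun C (- c).
    move=> abc; have -> : a = - b - c.
      by apply/eqP; rewrite -opprD -addr_eq0 addrA abc.
    exact: supportD.
  rewrite !support_dilate !supportZ // !support_reflect.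
  have := tri u v w uvw.
  have := tri v u w; rewrite (addrC v) => /(_ uvw).
  have := tri w u v; rewrite -addrA (addrC w) => /(_ uvw).
  by lra.
apply/andP; split; last exact: circumradius_le tP.
by apply: lb_le_inf; [exists 2; split => //; exists t | move=> x []].
Qed.

Lemma support_opp_le {R : realType} {C : set 'rV[R]_2} (u : 'rV[R]_2) :
  convex_body C -> minkowski_centered C -> C 0 ->
  support_fun C (- u) <= 2 * support_fun C u.
Proof.
move=> hC cC C0; have /andP[s0 s2] := asymmetry_le2 C hC.
have h0 := support_ge0 u hC C0.
apply: support_le => // x /cC [c Cc <-].
rewrite dotNl dotZr mulNr opprK.
have := dot_le_support u c hC Cc; move: (dot u c) => d dh.
have := ler_wpM2l s0 dh; have := ler_wpM2r h0 s2.
lra.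
Qed.

(** * From widths to the circumradius *)

(** Duality: maximizing [u . p + v . q + w . r] under the width bounds amounts
    to finding a point [z] in a triangle with edge vectors [u], [v], [w] for
    which the sum of the [g]-distances to the three vertices is small.  The
    point used has barycentric coordinates proportional to [e u], [e v],
    [e w]; when these all vanish a vertex works. *)
Lemma triple_from_widths {R : realType} {K C : set 'rV[R]_2} {rho : R} :
  convex_body K -> convex_body C -> C 0 -> 0 <= rho ->
  (forall u, support_fun C (- u) <= 2 * support_fun C u) ->
  (forall u x y, K x -> K y -> dot u (x - y) <=
     rho * Num.max (support_fun C u) (support_fun C (- u))) ->
  forall u v w, u + v + w = 0 ->
    support_fun K u + support_fun K v + support_fun K w <=
    rho * (support_fun C u + support_fun C v + support_fun C w).
Proof.
move=> hK hC C0 rho0 h2 wid u v w uvw.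
set h := support_fun C in h2 wid *.
have h0 a : 0 <= h a by exact: support_ge0.
have [p Kp ->] := support_attained u hK.
have [q Kq ->] := support_attained v hK.
have [r Kr ->] := support_attained w hK.
have width a b x y : K x -> K y -> h a <= b -> h (- a) <= b ->
    dot a (x - y) <= rho * b.
  move=> Kx Ky ab nab; apply: le_trans (wid a x y Kx Ky) _.
  by rewrite ler_wpM2l // ge_max ab nab.
pose e a := Num.max 0 (h (- a) - h a).
have e0 a : 0 <= e a by rewrite le_max lexx.
have eh a : e a <= h a by rewrite ge_max h0 /=; have := h2 a; lra.
have hN a : h (- a) <= h a + e a.
  by rewrite -lerBlDl le_max lexx orbT.
have wE : w = - u - v by apply/eqP; rewrite -opprD -addr_eq0 addrC uvw.
have [E0|En] := eqVneq (e u + e v + e w) 0.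
  (* Here [h] is symmetric enough on the triple to take a vertex for [z]. *)
  have ev0 : e v = 0 by have := e0 u; have := e0 v; have := e0 w; lra.
  have ew0 : e w = 0 by have := e0 u; have := e0 v; have := e0 w; lra.
  have := width v (h v) q p Kq Kp (lexx _); have := hN v; rewrite ev0 addr0.
  move=> nv /(_ nv).
  have := width w (h w) r p Kr Kp (lexx _); have := hN w; rewrite ew0 addr0.
  move=> nw /(_ nw).
  have := mulr_ge0 rho0 (h0 u).
  have -> : dot u p = - dot v p - dot w p by rewrite wE !dot_lin; ring.
  rewrite !(dotDr, dotNr); lra.
have E1 : 0 < e u + e v + e w.
  by rewrite lt_neqAle eq_sym En !addr_ge0.
have edge a b x y : K x -> K y ->
    dot (e a *: b - e b *: a) (x - y) <=
      rho * (e a * h b + e b * h a + e a * e b).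
  move=> Kx Ky.
  have sub c d : h (e c *: d - e d *: c) <= e c * h d + e d * (h c + e c).
    rewrite -scalerN; apply: le_trans (supportD _ _ hC) _.
    by rewrite !supportZ // lerD2l ler_wpM2l // hN.
  apply: width => //; first by have := sub a b; lra.
  by rewrite opprB; have := sub b a; lra.
have sumE : (e u + e v + e w) * (dot u p + dot v q + dot w r) =
    dot (e v *: w - e w *: v) (r - q) + dot (e w *: u - e u *: w) (p - r) +
    dot (e u *: v - e v *: u) (q - p).
  move: (e u) (e v) (e w) => eu ev ew; rewrite wE !dot_lin; ring.
rewrite -(ler_pM2l E1) sumE.
apply: le_trans (lerD (lerD (edge v w _ _ Kr Kq) (edge w u _ _ Kp Kr))
                  (edge u v _ _ Kq Kp)) _.
rewrite -!mulrDr mulrCA ler_wpM2l //.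
have := eh u; have := eh v; have := eh w.
have := e0 u; have := e0 v; have := e0 w.
move: (e u) (e v) (e w) (h u) (h v) (h w) => a b c hu hv hw c0 b0 a0 hc hb ha.
have := ler_wpM2l a0 ha; have := ler_wpM2l b0 hb; have := ler_wpM2l c0 hc.
have := sqr_ge0 (a - b); have := sqr_ge0 (b - c); have := sqr_ge0 (a - c).
rewrite !expr2; lra.
Qed.

Lemma circumradius_le_width {R : realType} {K C : set 'rV[R]_2} {rho : R} :
  convex_body K -> convex_body C -> minkowski_centered C -> C 0 -> 0 <= rho ->
  (forall u x y, K x -> K y -> dot u (x - y) <=
     rho * Num.max (support_fun C u) (support_fun C (- u))) ->
  circumradius K C <= rho.
Proof.
move=> hK hC cC C0 rho0 wid.
have h2 u := support_opp_le u hC cC C0.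
have hrC := convex_body_dilate rho C hC.
have [u v w uvw|t tP] := containment_triples _ _ hK hrC.
  rewrite !support_dilate !supportZ // -!mulrDr.
  exact: triple_from_widths.
exact: circumradius_le tP.
Qed.

(** * The four diameters bound the widths *)

Lemma absorb {R : realType} {n : nat} {C : set 'rV[R]_n} (M : R) :
  interior C 0 -> exists2 l, 0 < l & forall x, `|x| <= M -> dilate l C x.
Proof.
move=> /nbhs_ballP [r /= r0 rC].
pose m := Num.max 0 M.
have m0 : 0 < m + 1 by rewrite ltr_pwDr // le_max lexx.
exists ((m + 1) / r); first exact: divr_gt0.
move=> x xM; exists (((m + 1) / r)^-1 *: x); last first.
  by rewrite scalerA divff ?scale1r // gt_eqF // divr_gt0.
apply: rC; rewrite -ball_normE /= sub0r normrN normrZ.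
rewrite gtr0_norm ?invr_gt0 ?divr_gt0 // invf_div.
rewrite mulrAC ltr_pdivrMr // ltr_pM2l //.
by rewrite (le_lt_trans xM) // (@le_lt_trans _ _ m) ?ltrDl // le_max lexx orbT.
Qed.

Lemma support_gt0 {R : realType} {n : nat} {C : set 'rV[R]_n} (u : 'rV[R]_n) :
  convex_body C -> interior C 0 -> u != 0 -> 0 < support_fun C u.
Proof.
move=> hC C0 u0; have [l l0 /(_ u (lexx _)) [c Cc cu]] := absorb `|u| C0.
have := dot_gt0 u u0; rewrite -{2}cu dotZr pmulr_rgt0 // => uc.
exact: lt_le_trans uc (dot_le_support u c hC Cc).
Qed.

Lemma dot_le_dilate {R : realType} {n : nat} {C : set 'rV[R]_n} {l : R}
    (u x : 'rV[R]_n) : convex_body C -> 0 <= l -> dilate l C x ->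
  dot u x <= l * support_fun C u.
Proof.
move=> hC l0 [c Cc <-]; rewrite dotZr ler_wpM2l //.
exact: dot_le_support.
Qed.

Lemma gauge_le {R : realType} {n : nat} {C : set 'rV[R]_n} {l : R}
    {x : 'rV[R]_n} : 0 <= l -> dilate l C x -> gauge_fun C x <= l.
Proof. by move=> l0 lx; apply: ge_inf; [exists 0 => y [] | split]. Qed.

Lemma gauge_lt {R : realType} {n : nat} {C : set 'rV[R]_n} {l r : R}
    {x : 'rV[R]_n} : 0 <= l -> dilate l C x -> gauge_fun C x < r ->
  exists l', [/\ 0 <= l', l' < r & dilate l' C x].
Proof.
move=> l0 lx; case/inf_lt; first by exists l.
by move=> l' [l'0 l'x] l'r; exists l'.
Qed.

Lemma dilate_reflect {R : realType} {n : nat} {C : set 'rV[R]_n} {l : R}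
    {x : 'rV[R]_n} : dilate l C (- x) -> dilate l (reflect_set C) x.
Proof.
move=> [c Cc cx]; exists (- c); first by exists c.
by rewrite scalerN cx opprK.
Qed.

(** The diameters are suprema, which say nothing about unbounded sets; so in
    each case the values are first bounded, using that a multiple of [C]
    contains both [K] and [K - K].  The inequality [diam < rho] is strict so
    that dilation factors smaller than [rho] can be extracted from the infima
    that define gauges and circumradii. *)
Section Diameters.
Context {R : realType} {n : nat} {K C : set 'rV[R]_n}.
Hypotheses (hK : convex_body K) (hC : convex_body C) (C0 : interior C 0).

Let g u := Num.max (support_fun C u) (support_fun C (- u)).

Let diff_absorb : exists l, [/\ 0 < l, forall x, K x -> dilate l C x &
  forall x y, K x -> K y -> dilate l C (x - y)].
Proof.
have [_ /compact_bounded [M [_ Mb]] _] := hK.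
have M1 : M < M + 1 by rewrite ltrDl.
have {}Mb x : K x -> `|x| <= M + 1 by move=> Kx; exact: Mb.
have [l l0 lP] := absorb ((M + 1) + (M + 1)) C0.
exists l; split => // [x Kx|x y Kx Ky]; apply: lP.
  by have := Mb x Kx; have := normr_ge0 x; lra.
by rewrite (le_trans (ler_normB _ _)) // lerD // Mb.
Qed.

Let scale_le (l r : R) (u : 'rV[R]_n) b :
  0 <= l -> l <= r -> b <= g u -> l * b <= r * g u.
Proof.
move=> l0 lr bg; apply: le_trans (ler_wpM2l l0 bg) _; apply: ler_wpM2r lr.
have [-> | u0] := eqVneq u 0.
  by rewrite le_max support0 // lexx.
by rewrite le_max ltW // support_gt0.
Qed.

Lemma width_le_diam_MIN (rho : R) : diam_MIN K C < rho ->
  forall u x y, K x -> K y -> dot u (x - y) <= rho * g u.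
Proof.
move=> Drho u x y Kx Ky; have [l [l0 _ lK]] := diff_absorb.
have : gauge_fun C (x - y) <= diam_MIN K C.
  apply: ub_le_sup; last by exists x => //; exists y.
  exists l => _ [x' Kx' [y' Ky' <-]].
  by apply: gauge_le (lK _ _ Kx' Ky'); exact: ltW.
move=> /le_lt_trans /(_ Drho) /(gauge_lt (ltW l0) (lK _ _ Kx Ky)).
move=> [l' [l'0 l'r l'xy]]; apply: le_trans (dot_le_dilate u _ hC l'0 l'xy) _.
by apply: scale_le => //; [exact: ltW | rewrite le_max lexx].
Qed.

(** The two gauges control [u . (x - y)] by [h u] and [h (- u)] respectively,
    hence both by [g u], and the bounds can be averaged. *)
Lemma width_le_diam_HM (rho : R) : diam_HM K C < rho ->
  forall u x y, K x -> K y -> dot u (x - y) <= rho * g u.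
Proof.
move=> Drho u x y Kx Ky; have [l [l0 _ lK]] := diff_absorb.
have lK' x' y' : K x' -> K y' -> dilate l (reflect_set C) (x' - y').
  by move=> Kx' Ky'; apply: dilate_reflect; rewrite opprB; exact: lK.
set a := gauge_fun C (x - y); set b := gauge_fun (reflect_set C) (x - y).
have abD : 2^-1 * (a + b) <= diam_HM K C.
  apply: ub_le_sup; last by exists x => //; exists y.
  exists l => _ [x' Kx' [y' Ky' <-]].
  have := gauge_le (ltW l0) (lK _ _ Kx' Ky').
  have := gauge_le (ltW l0) (lK' _ _ Kx' Ky'); lra.
pose d := rho - 2^-1 * (a + b).
have d0 : 0 < d by rewrite subr_gt0 (le_lt_trans abD).
have [|l1 [l10 l1a l1xy]] := gauge_lt (r := a + d) (ltW l0) (lK _ _ Kx Ky).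
  by rewrite ltrDl.
have [|l2 [l20 l2b l2xy]] := gauge_lt (r := b + d) (ltW l0) (lK' _ _ Kx Ky).
  by rewrite ltrDl.
have h1 := dot_le_dilate u _ hC l10 l1xy.
have := dot_le_dilate u _ (convex_body_reflect C hC) l20 l2xy.
rewrite support_reflect => h2.
have g1 : l1 * support_fun C u <= l1 * g u.
  by apply: scale_le => //; rewrite le_max lexx.
have g2 : l2 * support_fun C (- u) <= l2 * g u.
  by apply: scale_le => //; rewrite le_max lexx orbT.
have : 2^-1 * (l1 + l2) * g u <= rho * g u.
  apply: scale_le => //; first by apply: mulr_ge0; rewrite ?addr_ge0.
  by rewrite /d in l1a l2b; lra.
lra.
Qed.

(** If [x] and [y] lie in [t + r C], then [u . (x - y)] is at most
    [r * (h u + h (- u))], hence at most [2 * r * g u]. *)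
Lemma width_le_diam_AM (rho : R) : diam_AM K C < rho ->
  forall u x y, K x -> K y -> dot u (x - y) <= rho * g u.
Proof.
move=> Drho u x y Kx Ky; have [l [l0 lK _]] := diff_absorb.
have [_ _ /convex_setP cK] := hK.
have seg x' y' : K x' -> K y' ->
    segment_set x' y' `<=` translate 0 (dilate l C).
  move=> Kx' Ky' _ [t /= /andP[t0 t1] <-].
  rewrite /translate /=; set z := _ + _; exists z; last by rewrite add0r.
  apply: lK; rewrite /z addrC; apply: cK => //.
have : 2 * circumradius (segment_set x y) C <= diam_AM K C.
  apply: ub_le_sup; last by exists x => //; exists y.
  exists (2 * l) => _ [x' Kx' [y' Ky' <-]].
  by rewrite ler_pM2l // (circumradius_le (ltW l0) (seg _ _ Kx' Ky')).
move=> /le_lt_trans /(_ Drho); rewrite mulrC -ltr_pdivlMr // => /inf_lt [].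
  by exists l; split; [exact: ltW | exists 0; exact: seg].
move=> r [r0 [t xyt]] rrho.
have /xyt [_ [c Cc <-] cx] : segment_set x y x.
  exists 0; first by rewrite /= in_itv /= lexx ler01.
  by rewrite subr0 scale1r scale0r addr0.
have /xyt [_ [d Cd <-] dy] : segment_set x y y.
  exists 1; first by rewrite /= in_itv /= lexx ler01.
  by rewrite subrr scale0r add0r scale1r.
rewrite -cx -dy !dot_lin.
have h1 : r * support_fun C u <= (rho / 2) * g u.
  by apply: scale_le => //; [exact: ltW | rewrite le_max lexx].
have h2 : r * support_fun C (- u) <= (rho / 2) * g u.
  by apply: scale_le => //; [exact: ltW | rewrite le_max lexx orbT].
have := ler_wpM2l r0 (dot_le_support u c hC Cc).
have := ler_wpM2l r0 (dot_le_support (- u) d hC Cd).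
rewrite dotNl; lra.
Qed.

Lemma width_le_diam_MAX (rho : R) : diam_MAX K C < rho ->
  forall u x y, K x -> K y -> dot u (x - y) <= rho * g u.
Proof.
move=> Drho u x y Kx Ky; have [l [l0 lK _]] := diff_absorb.
have [u0|u0] := eqVneq u 0.
  by rewrite u0 /g oppr0 dot0l support0 // maxxx mulr0.
have g0 v : v != 0 -> 0 < g v by move=> v0; rewrite lt_max support_gt0.
have wD : (support_fun K u + support_fun K (- u)) / g u <= diam_MAX K C.
  apply: ub_le_sup; last by exists u.
  exists (2 * l) => _ [v /= v0 <-]; rewrite ler_pdivrMr ?g0 //.
  have KC w : support_fun K w <= l * support_fun C w.
    by apply: support_le => // z /lK; apply: dot_le_dilate => //; exact: ltW.
  have h1 : l * support_fun C v <= l * g v.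
    by rewrite ler_pM2l // le_max lexx.
  have h2 : l * support_fun C (- v) <= l * g v.
    by rewrite ler_pM2l // le_max lexx orbT.
  apply: le_trans (lerD (le_trans (KC v) h1) (le_trans (KC (- v)) h2)) _.
  by rewrite -mulrA mulr_natl mulr2n.
move: wD; rewrite ler_pdivrMr ?g0 // => wD.
have := dot_le_support u x hK Kx; have := dot_le_support (- u) y hK Ky.
have : diam_MAX K C * g u <= rho * g u by rewrite ler_pM2r ?g0 // ltW.
rewrite dotNl dotDr dotNr; lra.
Qed.

End Diameters.

Theorem corollary4p6 (R : realType) (K C : set 'rV[R]_2)
  (hK : convex_body K) (hC : convex_body C)
  (hCc : minkowski_centered C) (hC0 : interior C 0) (M : mean_kind) :
  diam M K C >= circumradius K C.
Proof.
have width rho : diam M K C < rho -> forall u x y, K x -> K y ->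
    dot u (x - y) <= rho * Num.max (support_fun C u) (support_fun C (- u)).
  case: M => /=; [exact: width_le_diam_MIN | exact: width_le_diam_HM |
                  exact: width_le_diam_AM | exact: width_le_diam_MAX].
suff R_le rho : diam M K C < rho -> circumradius K C <= rho.
  rewrite leNgt; apply/negP => DR; have [Dm mR] := midf_lt DR.
  by have := R_le _ Dm; rewrite leNgt mR.
move=> Drho; apply: circumradius_le_width (width _ Drho) => //.
  exact: interior_subset.
have [[x Kx] _ _] := hK; pose u : 'rV[R]_2 := const_mx 1.
have u0 : u != 0.
  by apply/eqP => /rowP /(_ 0); rewrite !mxE; apply/eqP; rewrite oner_eq0.
(* A strictly positive [g u] and the zero width of a point force
   [0 <= rho]. *)
have := width _ Drho u x x Kx Kx; rewrite subrr dot0r.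
by rewrite pmulr_lge0 // lt_max support_gt0.
Qed.
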